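(* Let $V$ be a finite set of voters and $C=\{c_1,c_2,c_3\}$. The following two constructions are well defined and mutually inverse, and hence give a one-to-one correspondence between SWFs $F$ satisfying conditions MIIA and CC, and consistent $3$-tuples of functions $(g_1,g_2,g_3)$, $g_i:\mathcal{P}(V)\to\{W,T,L\}$. (1) Given $F$, let $f_{i,i+1}$ be the relative SWFs with $\pi_{i,i+1}\circ F=f_{i,i+1}\circ\pi_{i,i+1}$, and set $g_i=f_{i,i+1}\circ\zeta^{-1}$ for $i=1,2,3$. (2) Given $(g_1,g_2,g_3)$, set $f_{i,i+1}=g_i\circ\zeta$ on $A_{i,i+1}$ and $f_{i+1,i}(a)=-f_{i,i+1}(-a)$ for $a\in A_{i+1,i}$, and let $F$ be the SWF on $\mathfrak{C}^V$ with $\pi_{i,j}\circ F=f_{i,j}\circ\pi_{i,j}$ for all $i\ne j$.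
   Context: Setting. $V$ is a finite set of voters, $C=\{c_1,c_2,c_3\}$ is the set of candidates, with indices treated modulo $3$. A ballot is a bijection $r:C\to\{0,1,2\}$ ($r^{-1}(2)$ is the highest ranked candidate, $r^{-1}(0)$ the lowest); it is also written as the list of candidates from highest to lowest. $\mathfrak{R}$ is the set of all ballots. The Condorcet cycle is $\mathfrak{C}=\{c_1c_2c_3,\ c_2c_3c_1,\ c_3c_1c_2\}\subset\mathfrak{R}$. An election domain is a subset $E\subset\mathfrak{R}^V$; its elements are elections $e$, with $e(v)$ the ballot of $v$. An election result $\succ$ is a weak ordering of $C$ (ties allowed). A SWF (social welfare function) is a function $F$ from $E$ to the set of weak orderings of $C$. Condition CC: $E=\mathfrak{C}^V$. For $i\ne j$ and $e\in E$ let $\pi_{i,j}(e)\in\mathbb{Z}^V$ be $\pi_{i,j}(e)(v)=e(v)(c_i)-e(v)(c_j)$, and let $A_{i,j}=\pi_{i,j}(E)$. Under CC, $A_{i,i+1}=\{1,-2\}^V$ and $A_{i+1,i}=\{2,-1\}^V$. For a result $\succ$, $\pi_{i,j}(\succ)=W$ if $c_i\succ c_j$, $L$ if $c_j\succ c_i$, and $T$ if they are tied. Write $-W=L$, $-L=W$, $-T=T$. MIIA: for all $i\ne j$ there is a function (relative SWF) $f_{i,j}:A_{i,j}\to\{W,T,L\}$ with $f_{i,j}(\pi_{i,j}(e))=\pi_{i,j}(F(e))$ for all $e\in E$. $\mathcal{P}(V)$ is the power set of $V$. The bijection $\zeta:\{1,-2\}^V\to\mathcal{P}(V)$ is $\zeta(a)=\{v:a(v)=-2\}$,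 with inverse $\zeta^{-1}(U)(v)=1-3\cdot\mathbf{1}_{v\in U}$. A multiset of size three with elements in $\{W,T,L\}$ is consistent if it is one of $\{W,W,L\}$, $\{W,T,L\}$, $\{W,L,L\}$, $\{T,T,T\}$. A $3$-tuple $(g_1,g_2,g_3)$ of functions $g_i:\mathcal{P}(V)\to\{W,T,L\}$ is consistent if for every ordered partition $V=V_1\sqcup V_2\sqcup V_3$ (parts may be empty) the multiset $\{g_1(V_1),g_2(V_2),g_3(V_3)\}$ is consistent. *)

(* Defs.v *)
From HB Require Import structures.
From mathcomp Require Import all_boot all_order all_algebra all_fingroup.

Set Implicit Arguments.
Unset Strict Implicit.
Unset Printing Implicit Defensive.

Import GRing.Theory.
Local Open Scope ring_scope.

(* The candidate c_k is the residue of k modulo 3; in particular c_3 is       *)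
(* [3 : candidate], which is also [0], and [i + 1] is the cyclic successor.   *)
Notation candidate := 'I_3.

(* A ballot maps each candidate to its score in {0,1,2}, 2 being the highest. *)
Notation ballot := {perm 'I_3}.

(* From the highest ranked candidate to the lowest.                           *)
Definition ballot_list (r : ballot) : seq candidate :=
  [:: (r^-1)%g 2; (r^-1)%g 1; (r^-1)%g 0].

Definition condorcet_cycle : {set ballot} :=
  [set r | ballot_list r \in
     [:: [:: 1; 2; 3]; [:: 2; 3; 1]; [:: 3; 1; 2]]].

Notation election V := {ffun V -> ballot}.

Definition CC (V : finType) (E : {set election V}) : Prop :=
  E = [set e : election V | [forall v, e v \in condorcet_cycle]].

(* [R (i, j)] reads "c_i is ranked at least as high as c_j".                  *)
Definition is_weak_ordering (R : {ffun candidate * candidate -> bool}) : bool :=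
  [forall i, forall j, R (i, j) || R (j, i)] &&
  [forall i, forall j, forall k, R (i, j) ==> R (j, k) ==> R (i, k)].

Definition weak_ordering := {R | is_weak_ordering R}.

Definition SWF (V : finType) (E : {set election V}) :=
  {ffun {e : election V | e \in E} -> weak_ordering}.

Variant outcome := Win | Tie | Loss.

Definition opp_outcome (x : outcome) : outcome :=
  match x with Win => Loss | Tie => Tie | Loss => Win end.

Definition option_of_outcome (x : outcome) : option bool :=
  match x with Win => Some true | Tie => None | Loss => Some false end.

Definition outcome_of_option (x : option bool) : outcome :=
  match x with Some true => Win | None => Tie | Some false => Loss end.

Fact option_of_outcomeK : cancel option_of_outcome outcome_of_option.
Proof. by case. Qed.

HB.instance Definition _ := Equality.copy outcome (can_type option_of_outcomeK).

Definition result_outcome (i j : candidate) (s : weak_ordering) : outcome :=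
  if ~~ val s (j, i) then Win else if ~~ val s (i, j) then Loss else Tie.

Section SocialWelfareFunctions.
Variable V : finType.
Implicit Types (E : {set election V}) (i j : candidate).

Definition profile i j (e : election V) : {ffun V -> int} :=
  [ffun v => (e v i)%:Z - (e v j)%:Z].

(* The set A_{i,j}, as a list because int is infinite.                        *)
Definition profiles E i j : seq {ffun V -> int} :=
  [seq profile i j e | e in E].

Definition profile_type E i j := {a : {ffun V -> int} | a \in profiles E i j}.

Definition relative_SWF E i j := profile_type E i j -> outcome.

Fact profile_in_subproof E i j (e : {e : election V | e \in E}) :
  profile i j (val e) \in profiles E i j.
Proof. by apply: image_f; apply: valP. Qed.

Definition profile_in E i j (e : {e : election V | e \in E}) :
  profile_type E i j := Sub (profile i j (val e)) (profile_in_subproof i j e).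

Fact profile_opp_subproof E i j (a : profile_type E i j) :
  - val a \in profiles E j i.
Proof.
case: a => _ /= /imageP[e eE ->]; apply/imageP; exists e => //.
by apply/ffunP=> v; rewrite !ffunE opprB.
Qed.

Definition profile_opp E i j (a : profile_type E i j) : profile_type E j i :=
  Sub (- val a) (profile_opp_subproof a).

Definition is_relative_SWF E (F : SWF E) i j (f : relative_SWF E i j) : Prop :=
  forall e, f (profile_in i j e) = result_outcome i j (F e).

Definition MIIA E (F : SWF E) : Prop :=
  forall i j, i != j -> exists f : relative_SWF E i j, is_relative_SWF F f.

(* [zeta] is total, but is only applied to elements of {1,-2}^V.              *)
Definition zeta (a : {ffun V -> int}) : {set V} := [set v | a v == -2].

Definition zeta_inv (U : {set V}) : {ffun V -> int} :=
  [ffun v => 1 - 3 * (v \in U)%:Z].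

Fact cyclic_ballot_inj i : injective (fun k : candidate => i - k).
Proof. by move=> k l /addrI/oppr_inj. Qed.

(* The ballot c_{i+1} c_{i+2} c_i.                                            *)
Definition cyclic_ballot i : ballot := perm (@cyclic_ballot_inj i).

Fact cyclic_ballotP i : cyclic_ballot i \in condorcet_cycle.
Proof.
have rV k : (cyclic_ballot i)^-1%g k = i - k.
  by apply/esym/(canRL (permK _)); rewrite permE subKr.
by rewrite inE /ballot_list !rV; case: i {rV} => [[|[|[|]]]].
Qed.

Fact condorcet_cycleP (r : ballot) :
  r \in condorcet_cycle -> exists i, r = cyclic_ballot i.
Proof.
rewrite inE => rl; exists ((r^-1)%g 0).
have rV k : (r^-1)%g k = (r^-1)%g 0 - k.
  have [->|[->|->]] : k = 0 \/ k = 1 \/ k = 2.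
  - by case: k => [[|[|[|]]] kP] //; [left|right; left|right; right]; apply/val_inj.
  - by rewrite subr0.
  - by move: rl; rewrite !inE => /or3P[] /eqP[e2 e1 e0];
    rewrite ?e2 ?e1 e0; apply/eqP.
  - by move: rl; rewrite !inE => /or3P[] /eqP[e2 e1 e0];
    rewrite ?e2 ?e1 e0; apply/eqP.
apply/permP=> k; rewrite permE.
by rewrite -[RHS](permKV r) rV subKr.
Qed.

Fact profiles_nextP E i (a : {ffun V -> int}) : CC E ->
  reflect (forall v, a v = 1 \/ a v = -2) (a \in profiles E i (i + 1)).
Proof.
move=> ->; apply: (iffP imageP) => [[e + ->] v | aP].
  rewrite inE => /forallP/(_ v)/condorcet_cycleP[k ek].
  rewrite ffunE ek !permE.
  case: i k {ek} => [[|[|[|?]]] ?] [[|[|[|?]]] ?] //=; (by left) || by right.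
exists [ffun v => cyclic_ballot (if a v == 1 then i - 1 else i)].
  by rewrite inE; apply/forallP=> v; rewrite ffunE cyclic_ballotP.
apply/ffunP=> v; rewrite !ffunE !permE.
by case: (aP v) => ->; case: i {aP} => [[|[|[|]]]].
Qed.

Fact zeta_inv_subproof E i (U : {set V}) :
  CC E -> zeta_inv U \in profiles E i (i + 1).
Proof.
by move=> hE; apply/profiles_nextP=> // v; rewrite ffunE; case: (v \in U);
  [right | left].
Qed.

Definition zeta_inv_in E (hE : CC E) i (U : {set V}) :
  profile_type E i (i + 1) := Sub (zeta_inv U) (zeta_inv_subproof i U hE).

Definition consistent_multiset (s : seq outcome) : bool :=
  has (perm_eq s)
    [:: [:: Win; Win; Loss]; [:: Win; Tie; Loss];
        [:: Win; Loss; Loss]; [:: Tie; Tie; Tie]].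

Definition outcome_triple := {ffun candidate -> {ffun {set V} -> outcome}}.

Definition consistent (g : outcome_triple) : Prop :=
  forall V1 V2 V3 : {set V},
    V1 :|: V2 :|: V3 = setT ->
    [disjoint V1 & V2] -> [disjoint V1 & V3] -> [disjoint V2 & V3] ->
    consistent_multiset [:: g 1 V1; g 2 V2; g 3 V3].

(* [g] is obtained from [F] by construction (1).                              *)
Definition SWF_to_triple E (hE : CC E) (F : SWF E) (g : outcome_triple) : Prop :=
  exists f : forall i, relative_SWF E i (i + 1),
    (forall i, is_relative_SWF F (f i)) /\
    (forall i U, g i U = f i (zeta_inv_in hE i U)).

(* [F] is obtained from [g] by construction (2).                              *)
Definition triple_to_SWF E (g : outcome_triple) (F : SWF E) : Prop :=
  exists f : forall i j, relative_SWF E i j,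
    [/\ forall i (a : profile_type E i (i + 1)), f i (i + 1) a = g i (zeta (val a)),
        forall i (a : profile_type E (i + 1) i),
          f (i + 1) i a = opp_outcome (f i (i + 1) (profile_opp a)) &
        forall i j, i != j -> is_relative_SWF F (f i j)].

End SocialWelfareFunctions.

(* Main.v *)
Require Import Defs.
From mathcomp Require Import all_boot all_order all_algebra all_fingroup.
From Stdlib Require Import ProofIrrelevance.

(** Both constructions are governed by one relation between [F] and [g]: the
    outcome of c_i against c_{i+1} in [F e] is [g i] evaluated at the set of
    voters ranking c_i last and c_{i+1} first.  In an election in the Condorcet
    cycle these three sets of voters form an ordered partition of V, and every
    ordered partition arises in this way.  As the three cyclic outcomes of a
    weak ordering determine it, and are exactly the consistent triples, the
    relation is a bijection. *)

Set Implicit Arguments.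
Unset Strict Implicit.
Unset Printing Implicit Defensive.

Import GRing.Theory.
Local Open Scope ring_scope.

(** Names the residue 0 as [3], so that the cases match the indices in [consistent]. *)
Lemma candidate_cases (P : candidate -> Prop) : P 1 -> P 2 -> P 3 -> forall i, P i.
Proof.
move=> P1 P2 P3 [[|[|[|//]]] lti].
- by rewrite (_ : Ordinal _ = 3) //; apply/val_inj.
- by rewrite (_ : Ordinal _ = 1) //; apply/val_inj.
- by rewrite (_ : Ordinal _ = 2) //; apply/val_inj.
Qed.

Lemma candidate_neq (i j : candidate) : i != j -> j = i + 1 \/ i = j + 1.
Proof.
by elim/candidate_cases: i; elim/candidate_cases: j => // _;
  (by left; apply/eqP) || (by right; apply/eqP).
Qed.

Lemma next_next_neq (i : candidate) : (i == i + 1 + 1) = false.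
Proof. by elim/candidate_cases: i. Qed.

Lemma next_neq (i : candidate) : i != i + 1.
Proof. by elim/candidate_cases: i. Qed.

Lemma weak_ordering_total (s : weak_ordering) i j : val s (i, j) || val s (j, i).
Proof. by have /andP[/forallP/(_ i)/forallP/(_ j)] := valP s. Qed.

Lemma weak_ordering_trans (s : weak_ordering) i j k :
  val s (i, j) -> val s (j, k) -> val s (i, k).
Proof.
have /andP[_ /forallP/(_ i)/forallP/(_ j)/forallP/(_ k)] := valP s.
by move=> /implyP sP /sP/implyP.
Qed.

Lemma result_outcomeC (s : weak_ordering) i j :
  result_outcome j i s = opp_outcome (result_outcome i j s).
Proof.
have := weak_ordering_total s i j; rewrite /result_outcome.
by case: (val s (i, j)); case: (val s (j, i)).
Qed.

Lemma result_outcome_lossE (s : weak_ordering) i j :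
  val s (i, j) = (result_outcome i j s != Loss).
Proof.
have := weak_ordering_total s i j; rewrite /result_outcome.
by case: (val s (i, j)); case: (val s (j, i)).
Qed.

(** Modulo 3, two distinct candidates are always cyclic neighbours in one order or the other; the
    diagonal is fixed by totality. *)
Lemma eq_weak_ordering (s t : weak_ordering) :
  (forall i, result_outcome i (i + 1) s = result_outcome i (i + 1) t) -> s = t.
Proof.
move=> st; apply/val_inj/ffunP=> -[i j].
have [<-|/candidate_neq[->|->]] := eqVneq i j.
- have := weak_ordering_total s i i; have := weak_ordering_total t i i.
  by rewrite !orbb => -> ->.
- by rewrite !result_outcome_lossE st.
- by rewrite !result_outcome_lossE !(result_outcomeC _ j) st.
Qed.

(** A consistent multiset is all ties or contains both [Win] and [Loss]. Without a [Loss],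
    transitivity around the cycle forces ties everywhere; without a [Win], the reversed cycle does
    the same. *)
Lemma weak_ordering_consistent (s : weak_ordering) :
  consistent_multiset [seq result_outcome i (i + 1) s | i <- [:: 1; 2; 3]].
Proof.
have [e1 e2 e3] : [/\ 1 + 1 = 2 :> candidate, 2 + 1 = 3 :> candidate
  & 3 + 1 = 1 :> candidate] by split; apply/eqP.
rewrite /= e1 e2 e3 /result_outcome.
have := (weak_ordering_total s 1 2, weak_ordering_total s 2 3,
  weak_ordering_total s 3 1).
have := (@weak_ordering_trans s 1 2 3, @weak_ordering_trans s 2 3 1,
  @weak_ordering_trans s 3 1 2).
have := (@weak_ordering_trans s 2 1 3, @weak_ordering_trans s 3 2 1,
  @weak_ordering_trans s 1 3 2).
move: (val s (1, 2)) (val s (2, 1)) (val s (2, 3)) (val s (3, 2))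
  (val s (3, 1)) (val s (1, 3)).
by do 6!case; move=> [[p q] r] [[p' q'] r'] [[p'' q''] r''] //;
  first [by move: (p isT isT) | by move: (q isT isT) | by move: (r isT isT)
    | by move: (p' isT isT) | by move: (q' isT isT) | by move: (r' isT isT)].
Qed.

(** Kept apart from [weak_ordering] because it is transitive only when the three outcomes are
    consistent. *)
Definition cyclic_relation (o : candidate -> outcome) :
    {ffun candidate * candidate -> bool} :=
  [ffun p => [|| p.1 == p.2, (p.2 == p.1 + 1) && (o p.1 != Loss)
                | (p.1 == p.2 + 1) && (o p.2 != Win)]].

Lemma cyclic_relation_weak_ordering o :
  consistent_multiset [seq o i | i <- [:: 1; 2; 3]] ->
  is_weak_ordering (cyclic_relation o).
Proof.
move=> /= oP; apply/andP; split.
  apply/forallP=> i; apply/forallP=> j; rewrite !ffunE /=.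
  have [//|/candidate_neq[->|->]] := eqVneq i j.
    by rewrite eqxx; case: (o i); rewrite !orbT.
  by rewrite eqxx; case: (o j); rewrite !orbT.
apply/forallP=> i; apply/forallP=> j; apply/forallP=> k; rewrite !ffunE /=.
move: oP; elim/candidate_cases: i; elim/candidate_cases: j;
  elim/candidate_cases: k => /=;
  by case: (o 1) (o 2) (o 3) => [] [] [].
Qed.

Definition cyclic_weak_ordering o
    (oP : consistent_multiset [seq o i | i <- [:: 1; 2; 3]]) : weak_ordering :=
  Sub (cyclic_relation o) (cyclic_relation_weak_ordering oP).

Lemma result_outcome_cyclic o oP i :
  result_outcome i (i + 1) (@cyclic_weak_ordering o oP) = o i.
Proof.
rewrite /result_outcome !ffunE /= eqxx next_next_neq eq_sym (negPf (next_neq i)).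
by case: (o i).
Qed.

(** The difference -2 means that c_i is last and c_{i+1} first, while [cyclic_ballot k] has c_k last
    and c_{k+1} first. *)
Lemma profile_cyclic_ballot (i k : candidate) :
  ((cyclic_ballot k i)%:Z - (cyclic_ballot k (i + 1))%:Z == -2) = (k == i).
Proof.
rewrite !permE.
by elim/candidate_cases: i; elim/candidate_cases: k.
Qed.

Section Correspondence.
Variables (V : finType) (E : {set election V}).
Hypothesis hE : CC E.
Implicit Types (F : SWF E) (g : outcome_triple V) (i j : candidate).

Local Notation elections := {e : election V | e \in E}.

Lemma profileN i j (e : election V) : - profile i j e = profile j i e.
Proof. by apply/ffunP=> v; rewrite !ffunE opprB. Qed.

Lemma zetaK i (a : profile_type E i (i + 1)) : zeta_inv (zeta (val a)) = val a.
Proof.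
apply/ffunP=> v; rewrite ffunE inE.
by case: (profiles_nextP i _ hE (valP a) v) => ->.
Qed.

Lemma zeta_inj i (a b : profile_type E i (i + 1)) :
  zeta (val a) = zeta (val b) -> a = b.
Proof. by move=> ab; apply/val_inj; rewrite -zetaK ab zetaK. Qed.

Lemma zeta_invK (U : {set V}) : zeta (zeta_inv U) = U.
Proof. by apply/setP=> v; rewrite inE ffunE; case: (v \in U). Qed.

Lemma cyclic_election_subproof (k : V -> candidate) :
  [ffun v => cyclic_ballot (k v)] \in E.
Proof.
by rewrite hE inE; apply/forallP=> v; rewrite ffunE cyclic_ballotP.
Qed.

Definition cyclic_election (k : V -> candidate) : elections :=
  Sub [ffun v => cyclic_ballot (k v)] (cyclic_election_subproof k).

Lemma cyclic_election_onto (e : elections) :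
  exists k, e = cyclic_election k.
Proof.
(* Stated with boolean equality so that [xchoose] can select an index for each voter. *)
have eP v : exists k, val e v == cyclic_ballot k.
  have := valP e; move: (val e) => r; rewrite hE inE => /forallP/(_ v).
  by move=> /condorcet_cycleP[k ->]; exists k.
exists (fun v => xchoose (eP v)); apply/val_inj/ffunP=> v.
by rewrite ffunE; apply/eqP/(xchooseP (eP v)).
Qed.

(** The three sets read off from an election are thus the fibres of [k], which partition the
    voters. *)
Lemma zeta_cyclic_election k i :
  zeta (profile i (i + 1) (val (cyclic_election k))) = [set v | k v == i].
Proof. by apply/setP=> v; rewrite !inE !ffunE profile_cyclic_ballot. Qed.

Definition corresponds F g :=
  forall i e, result_outcome i (i + 1) (F e) = g i (zeta (profile i (i + 1) (val e))).

Lemma SWF_to_tripleP F g : SWF_to_triple hE F g <-> corresponds F g.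
Proof.
split=> [[f [fF gf]] i e | Fg].
  rewrite gf -fF; congr (f i _).
  by apply: zeta_inj; rewrite /= zeta_invK.
exists (fun i a => g i (zeta (val a))); split=> [i e | i U]; first by rewrite Fg.
by rewrite /= zeta_invK.
Qed.

Lemma triple_to_SWFP F g : triple_to_SWF g F <-> corresponds F g.
Proof.
split=> [[f [fg _ fF]] i e | Fg]; first by rewrite -fF ?next_neq // fg.
(* For [i != j] the second branch is reached only when [i = j + 1]; on the diagonal it gives an
   arbitrary value. *)
exists (fun i j a => if j == i + 1 then g i (zeta (val a))
                     else opp_outcome (g j (zeta (- val a)))).
split=> [i a | i a | i j /candidate_neq[->|->] e]; rewrite ?eqxx //.
- by rewrite next_next_neq.
- by rewrite Fg.
- by rewrite next_next_neq result_outcomeC Fg /= profileN.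
Qed.

Lemma corresponds_MIIA F g : corresponds F g -> MIIA F.
Proof. by move=> /triple_to_SWFP[f [_ _ fF]] i j /fF; exists (f i j). Qed.

Lemma corresponds_consistent F g : corresponds F g -> consistent g.
Proof.
move=> Fg V1 V2 V3 VU V12 V13 V23.
(* Each voter is sent to the index of its block, so the fibres of [k] are [V1], [V2], [V3]. *)
pose k v : candidate := if v \in V1 then 1 else if v \in V2 then 2 else 3.
have := weak_ordering_consistent (F (cyclic_election k)).
rewrite /= !Fg !zeta_cyclic_election.
congr (consistent_multiset [:: g _ _; g _ _; g _ _]); apply/setP=> v;
  rewrite !inE /k; have := in_setT v; rewrite -VU !inE;
  have := (disjointFr V12 (x := v), disjointFr V13 (x := v), disjointFr V23 (x := v));
  by case: (v \in V1) (v \in V2) (v \in V3) => [] [] [] // [[p q] r];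
    first [discriminate (p isT) | discriminate (q isT) | discriminate (r isT)].
Qed.

Lemma corresponds_inj F F' g : corresponds F g -> corresponds F' g -> F = F'.
Proof. by move=> Fg F'g; apply/ffunP=> e; apply: eq_weak_ordering=> i; rewrite Fg F'g. Qed.

(** An election realising an arbitrary [U] as its set at index [i]; this makes every value of [g]
    visible in [F]. Sending the other voters to [i + 1] is one of several possible choices. *)
Definition pair_election i (U : {set V}) : elections :=
  cyclic_election (fun v => if v \in U then i else i + 1).

Lemma zeta_pair_election i U :
  zeta (profile i (i + 1) (val (pair_election i U))) = U.
Proof.
rewrite zeta_cyclic_election; apply/setP=> v; rewrite inE.
by case: (v \in U); rewrite ?eqxx // eq_sym (negPf (next_neq i)).
Qed.

Lemma corresponds_fun F g g' : corresponds F g -> corresponds F g' -> g = g'.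
Proof.
move=> Fg Fg'; apply/ffunP=> i; apply/ffunP=> U.
by rewrite -(zeta_pair_election i U) -Fg Fg'.
Qed.

Definition triple_of_SWF F : outcome_triple V :=
  [ffun i => [ffun U => result_outcome i (i + 1) (F (pair_election i U))]].

(** By MIIA the outcome depends only on the profile, hence only on its image under the injective
    [zeta], so [pair_election] may stand in for any election with the same set. *)
Lemma triple_of_SWFP F : MIIA F -> corresponds F (triple_of_SWF F).
Proof.
move=> FM i e; have [f fF] := FM i _ (next_neq i); rewrite !ffunE -!fF.
by congr (f _); apply: zeta_inj; rewrite zeta_pair_election.
Qed.

Lemma consistent_outcomes g (gP : consistent g) (e : elections) :
  consistent_multiset
    [seq g i (zeta (profile i (i + 1) (val e))) | i <- [:: 1; 2; 3]].
Proof.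
have [k ->] := cyclic_election_onto e; rewrite /= !zeta_cyclic_election.
apply: gP.
  by apply/setP=> v; rewrite !inE; elim/candidate_cases: (k v).
all: rewrite -setI_eq0; apply/eqP/setP=> v; rewrite !inE.
all: by elim/candidate_cases: (k v).
Qed.

Definition SWF_of_triple g (gP : consistent g) : SWF E :=
  [ffun e => cyclic_weak_ordering (consistent_outcomes gP e)].

Lemma SWF_of_tripleP g (gP : consistent g) : corresponds (SWF_of_triple gP) g.
Proof. by move=> i e; rewrite ffunE result_outcome_cyclic. Qed.

End Correspondence.

Theorem mainTheorem4 (V : finType) (E : {set election V}) (hE : CC E) :
  exists (Phi : {F : SWF E | MIIA F} -> {g : outcome_triple V | consistent g})
         (Psi : {g : outcome_triple V | consistent g} -> {F : SWF E | MIIA F}),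
    [/\ forall F g, SWF_to_triple hE (sval F) g <-> g = sval (Phi F),
        forall g F, triple_to_SWF (sval g) F <-> F = sval (Psi g),
        cancel Phi Psi
      & cancel Psi Phi].
Proof.
pose Phi (F : {F : SWF E | MIIA F}) : {g : outcome_triple V | consistent g} :=
  exist _ _ (corresponds_consistent hE (triple_of_SWFP hE (svalP F))).
pose Psi (g : {g : outcome_triple V | consistent g}) : {F : SWF E | MIIA F} :=
  exist _ _ (corresponds_MIIA (SWF_of_tripleP hE (svalP g))).
have PhiP F : corresponds (sval F) (sval (Phi F)).
  exact: triple_of_SWFP (svalP F).
have PsiP g : corresponds (sval (Psi g)) (sval g).
  exact: SWF_of_tripleP (svalP g).
(* [MIIA] and [consistent] are propositions rather than booleans, so equality in the subtypes rests
   on proof irrelevance. *)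
have sval_inj T (P : T -> Prop) (x y : sig P) : sval x = sval y -> x = y.
  by case: x y => [x Px] [y Py] /= xy; apply: subset_eq_compat.
exists Phi, Psi; split=> [F g | g F | F | g].
- split=> [/SWF_to_tripleP Fg | ->]; first exact: (corresponds_fun hE Fg).
  exact/SWF_to_tripleP.
- split=> [/triple_to_SWFP Fg | ->]; first exact: (corresponds_inj Fg).
  exact/triple_to_SWFP.
(* Both [Psi (Phi F)] and [F] correspond to [Phi F]; the last case is symmetric. *)
- exact/sval_inj/(corresponds_inj (PsiP _)).
- exact/sval_inj/(corresponds_fun hE (PhiP _)).
Qed.
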